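(* Let $(\Sigma,\sigma)$ be a topologically transitive countable Markov shift with alphabet $\mathbb{N}$ satisfying the $\mathcal{F}$-property, and let $\phi:\Sigma\to\mathbb{R}$ be a potential with summable variations and with pressure $P(\phi)<\infty$. Then the following three conditions are equivalent. (UCS) (Uniformly contracting structure) $$\chi_{per}(\phi):=\sup\left\{\tfrac1n S_n\phi(x): x\in\Sigma,\ n\in\mathbb{N},\ \sigma^n(x)=x\right\}<P(\phi).$$ (CRC) (Compact returns contract) For every $q\in\mathbb{N}$ there exist $C_q\in\mathbb{R}$ and $\lambda_q<P(\phi)$ such that for all $n\in\mathbb{N}$ and all $x\in\Sigma$ with $x_0\le q$ and $x_n\le q$, $$S_n\phi(x)\le C_q+n\lambda_q.$$ (CI) (Contraction at infinity) $\delta_{\phi,\infty}<P(\phi)$.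
   Context: Countable Markov shift: given an alphabet $\mathcal{A}=\mathbb{N}=\{1,2,\dots\}$ and a $0$-$1$ transition matrix $M=(M_{i,j})_{i,j\in\mathcal{A}}$, set $\Sigma=\{(x_0,x_1,\dots)\in\mathcal{A}^{\mathbb{N}_0}: M_{x_i,x_{i+1}}=1\ \forall i\ge0\}$ with shift $\sigma(x_0,x_1,\dots)=(x_1,x_2,\dots)$. A $k$-cylinder is $[x_0,\dots,x_{k-1}]=\{y\in\Sigma: y_i=x_i,\ 0\le i\le k-1\}$ for an admissible word $x_0,\dots,x_{k-1}$ (i.e. consecutive letters are allowed transitions); $\mathcal{C}_k$ is the set of $k$-cylinders. The system is topologically transitive if for all $a,b\in\mathcal{A}$ there is $N_{ab}$ (a positive integer) with $[a]\cap\sigma^{-N_{ab}}[b]\ne\emptyset$. Write $S_n\phi=\sum_{i=0}^{n-1}\phi\circ\sigma^i$. The $k$-th variation is $var_k(\phi)=\sup\{|\phi(x)-\phi(y)|: x_i=y_i,\ 0\le i\le k-1\}$; $\phi$ has summable variations if $B_\phi:=\sum_{k\ge2}var_k(\phi)<\infty$. Pressure: $P(\phi)$ is the Gurevich pressure $P(\phi)=\limsup_{n\to\infty}\frac1n\log\sum_{\sigma^nx=x}e^{S_n\phi(x)}\mathbf{1}_{[a]}(x)$, which is independent of $a\in\mathcal{A}$ by transitivity (and equals the supremum of $h_\nu(\sigma)+\int\phi\,d\nu$ over $\sigma$-invariant Borel probability measures $\nu$ with $\int\phi\,d\nu>-\infty$). $\mathcal{F}$-property: for every $a\in\mathcal{A}$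 and $n\in\mathbb{N}$ the number of points $x\in[a]$ with $\sigma^nx=x$ is finite. Definition of $\delta_{\phi,\infty}$: for $n,M,q\in\mathbb{N}$ let $$B(n,M,q)=\left\{[x_0,\dots,x_n]\in\mathcal{C}_{n+1}: x_0,x_n\le q,\ \#\{0\le k\le n: x_k\le q\}\le\tfrac{n+1}{M}\right\},$$ $z_{\phi,n}(M,q)=\sup\{\frac1nS_n\phi(x): x\in B\text{ for some }B\in B(n,M,q)\}$ (with $\sup\emptyset=-\infty$), $\delta_{\phi,\infty}(M,q)=\limsup_{n\to\infty}z_{\phi,n}(M,q)$, $\delta_{\phi,\infty}(q)=\liminf_{M\to\infty}\delta_{\phi,\infty}(M,q)$, $\delta_{\phi,\infty}=\liminf_{q\to\infty}\delta_{\phi,\infty}(q)$ (the value $-\infty$ is allowed). *)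

(* Defs.v *)
From mathcomp Require Import all_boot all_order all_algebra.
From mathcomp Require Import all_classical all_reals all_analysis.

Set Implicit Arguments.
Unset Strict Implicit.
Unset Printing Implicit Defensive.

Import Order.TTheory GRing.Theory Num.Theory.
Import numFieldNormedType.Exports.

Local Open Scope classical_set_scope.
Local Open Scope ring_scope.

(* Letters are the positive elements of [nat], so that a threshold such as
   [x 0%N <= q] has its usual meaning; only the entries [M i j] with [0 < i]
   and [0 < j] matter.  A potential is a function on all of [nat -> nat], and
   only its values on [markov_shift M] are ever used. *)

Definition markov_shift (M : nat -> nat -> bool) : set (nat -> nat) :=
  [set x | (forall i, 0 < x i)%N /\ (forall i, M (x i) (x i.+1))].

Definition shift_map (x : nat -> nat) : nat -> nat := fun i => x i.+1.

Definition admissible (M : nat -> nat -> bool) (w : seq nat) : bool :=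
  all (fun a => 0 < a)%N w && sorted M w.

Definition markov_cylinder (M : nat -> nat -> bool) (w : seq nat) :
    set (nat -> nat) :=
  [set y | markov_shift M y /\ forall i, (i < size w)%N -> y i = nth 0%N w i].

Definition topologically_transitive (M : nat -> nat -> bool) : Prop :=
  forall a b : nat, (0 < a)%N -> (0 < b)%N ->
    exists2 N : nat, (0 < N)%N &
      (markov_cylinder M [:: a] `&`
       iter N shift_map @^-1` markov_cylinder M [:: b]) !=set0.

Definition periodic_points (M : nat -> nat -> bool) (n : nat) :
    set (nat -> nat) :=
  [set x | markov_shift M x /\ iter n shift_map x = x].

Definition F_property (M : nat -> nat -> bool) : Prop :=
  forall a n : nat, (0 < a)%N -> (0 < n)%N ->
    finite_set (markov_cylinder M [:: a] `&` periodic_points M n).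

Definition birkhoff_sum (R : realType) (phi : (nat -> nat) -> R) (n : nat)
    (x : nat -> nat) : R :=
  \sum_(i < n) phi (iter i shift_map x).

Definition variation (R : realType) (M : nat -> nat -> bool)
    (phi : (nat -> nat) -> R) (k : nat) : \bar R :=
  ereal_sup [set r | exists x y : nat -> nat,
    [/\ markov_shift M x, markov_shift M y,
        forall i, (i < k)%N -> x i = y i & r = `|phi x - phi y|%:E]].

Definition summable_variations (R : realType) (M : nat -> nat -> bool)
    (phi : (nat -> nat) -> R) : Prop :=
  (\sum_(2 <= k <oo) variation M phi k < +oo)%E.

(* [lne 0 = -oo], whereas [ln 0 = 0] would give a wrong value at the times [n]
   at which no periodic point starts with [a]. *)
Definition gurevich_pressure (R : realType) (M : nat -> nat -> bool)
    (phi : (nat -> nat) -> R) (a : nat) : \bar R :=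
  limn_esup (fun n : nat =>
    ((n%:R^-1)%:E *
     lne (\esum_(x in periodic_points M n)
            (expR (birkhoff_sum phi n x)
             * \1_(markov_cylinder M [:: a]) x)%:E))%E).

Definition chi_per (R : realType) (M : nat -> nat -> bool)
    (phi : (nat -> nat) -> R) : \bar R :=
  ereal_sup [set r | exists (n : nat) (x : nat -> nat),
    [/\ (0 < n)%N, periodic_points M n x
      & r = (n%:R^-1 * birkhoff_sum phi n x)%:E]].

Definition excursion_cylinders (M : nat -> nat -> bool) (n K q : nat) :
    set (set (nat -> nat)) :=
  [set B | exists w : seq nat,
    [/\ size w = n.+1, admissible M w, B = markov_cylinder M w,
        (nth 0%N w 0 <= q)%N /\ (nth 0%N w n <= q)%N
      & (count (fun a => a <= q)%N w)%:R <= n.+1%:R / K%:R :> rat]].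

Definition z_sup (R : realType) (M : nat -> nat -> bool)
    (phi : (nat -> nat) -> R) (n K q : nat) : \bar R :=
  ereal_sup [set r | exists (B : set (nat -> nat)) (x : nat -> nat),
    [/\ excursion_cylinders M n K q B, B x
      & r = (n%:R^-1 * birkhoff_sum phi n x)%:E]].

Definition delta_infty (R : realType) (M : nat -> nat -> bool)
    (phi : (nat -> nat) -> R) : \bar R :=
  limn_einf (fun q : nat =>
    limn_einf (fun K : nat =>
      limn_esup (fun n : nat => z_sup M phi n K q))).

Definition UCS (R : realType) (M : nat -> nat -> bool)
    (phi : (nat -> nat) -> R) (P : \bar R) : Prop :=
  (chi_per M phi < P)%E.

Definition CRC (R : realType) (M : nat -> nat -> bool)
    (phi : (nat -> nat) -> R) (P : \bar R) : Prop :=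
  forall q : nat, (0 < q)%N ->
    exists C lambda : R, (lambda%:E < P)%E /\
      forall (n : nat) (x : nat -> nat), (0 < n)%N -> markov_shift M x ->
        (x 0 <= q)%N -> (x n <= q)%N ->
        birkhoff_sum phi n x <= C + n%:R * lambda.

Definition CI (R : realType) (M : nat -> nat -> bool)
    (phi : (nat -> nat) -> R) (P : \bar R) : Prop :=
  (delta_infty M phi < P)%E.

(* Main.v *)
Require Import Defs.
From mathcomp Require Import all_boot all_order all_algebra.
From mathcomp Require Import all_classical all_reals all_analysis.
From mathcomp Require Import lra zify.

Set Implicit Arguments.
Unset Strict Implicit.
Unset Printing Implicit Defensive.

Import Order.TTheory GRing.Theory Num.Theory.
Import numFieldNormedType.Exports.

(** Write [P] for the pressure.  The basic device is to close orbit segments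
   into periodic orbits.  Since the variations are summable, the Birkhoff sums
   of two points over [n] steps differ by at most a constant [B] as soon as
   the points agree on the coordinates [0], ..., [n] ([birkhoff_distortion]);
   hence gluing two segments end to end changes the total Birkhoff sum by at
   most [2B] ([birkhoff_splice]).

   The equivalence of UCS and CRC is then direct.  A segment whose ends are at
   most [q] is closed by one of finitely many connecting paths, so a bound on
   periodic averages bounds the segment up to a constant ([UCS_returns]).
   Conversely a periodic orbit, wherever it lives, can be reached from the
   letter [1], run through many times and left again, so the bound on returns
   to [1] alone bounds its average ([CRC_UCS]).  The bound of [UCS_returns] has
   a rate that does not depend on [q], and this gives CI as well.

   The core is that CI implies UCS.  Suppose that periodic averages come
   arbitrarily close to [P].  By threading, long loops at [a] have averages
   close to [P], and CI forces each of them to spend a definite proportion of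
   its time at the letters up to some fixed [q].  This is impossible by
   [rare_visits]: a long loop with average close to [P] visits any given letter
   [b] with small frequency.  The reason is an entropy argument.  There are two
   distinct first-return loops at [b] ([two_first_returns]).  At each of the [m]
   visits of the given loop to [b], one may insert one of these or nothing.
   Weight a loop [w] by [exp (S w - |w| Q)], where [S w] is its Birkhoff sum,
   [|w|] its length, and [Q] is slightly larger than [P].  An insertion multiplies
   the weight by at least a fixed [r > 0], and all the choices give different loops, so
   the total weight is at least [(1 + r) ^ m] times the weight of the original
   loop ([insertions_weight]).  If [m] is proportional to the length [n], this
   grows exponentially in [n].  But the definition of [P] bounds the total
   weight of all loops at [a] of each large length by [1], while the lengths
   that occur are at most linear in [n] ([loop_weights_le_size]). *)

(** * Limits superior and inferior of sequences of extended reals *)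

Section Limits.
Local Open Scope classical_set_scope.
Local Open Scope ereal_scope.
Variable R : realType.
Implicit Types (u : (\bar R)^nat) (c : \bar R).

Lemma limn_esup_le u c k : (forall n, (k <= n)%N -> u n <= c) ->
  limn_esup u <= c.
Proof.
move=> uc; apply: (@le_trans _ _ (ereal_sup (u @` [set n | (k <= n)%N]))).
  apply: ereal_inf_lbound; exists [set n | (k <= n)%N] => //.
  by exists k.
by apply: ge_ereal_sup => _ [n /= kn <-]; exact: uc.
Qed.

Lemma limn_esup_lt u c : limn_esup u < c ->
  exists k, forall n, (k <= n)%N -> u n < c.
Proof.
move=> /ereal_inf_lt[_ [V [k _ kV] <-] Vc]; exists k => n kn.
by apply: le_lt_trans Vc; apply: ereal_sup_ubound; exists n => //; exact: kV.
Qed.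

Lemma limn_einf_le u c : (forall k, exists2 n, (k <= n)%N & u n <= c) ->
  limn_einf u <= c.
Proof.
move=> uc; rewrite leeNl; apply: le_ereal_inf_tmp => _ [V [k _ kV] <-].
have [n kn un] := uc k.
apply: (@le_trans _ _ (- u n)); first by rewrite leeN2.
by apply: ereal_sup_ubound; exists n => //; exact: kV.
Qed.

Lemma limn_einf_lt u c k : limn_einf u < c ->
  exists2 n, (k <= n)%N & u n < c.
Proof.
move=> uc; apply: contrapT => /forall2NP h; move: uc; apply/negP; rewrite -leNgt.
rewrite leeNr; apply: (@limn_esup_le _ _ k) => n kn /=.
rewrite leeN2 leNgt; apply/negP => unc.
by have [] := h n.
Qed.

End Limits.

(** * Loops of the transition graph and their periodic points *)

Section Loops.
Local Open Scope classical_set_scope.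
Variable M : nat -> nat -> bool.
Implicit Types (b c : nat) (u v w : seq nat) (x y t : nat -> nat).

(** A loop is a nonempty cyclic word of the transition graph; it is based at
   its first letter [head 0 w]. *)
Definition loop w := [&& w != [::], all (fun a => 0 < a)%N w & cycle M w].

Definition per w : nat -> nat := fun i => nth 0%N w (i %% size w).

Lemma iter_shift k x : iter k shift_map x = fun i => x (i + k)%N.
Proof.
elim: k => [|k IH]; first by apply/funext => i; rewrite addn0.
by rewrite iterS IH; apply/funext => i; rewrite /shift_map addnS.
Qed.

Lemma markov_shift_iter k x : markov_shift M x ->
  markov_shift M (iter k shift_map x).
Proof. by rewrite iter_shift => -[x0 xM]; split=> i //; rewrite addSn. Qed.

Lemma mkseq_per w : mkseq (per w) (size w) = w.
Proof.
apply: (@eq_from_nth _ 0%N); rewrite size_mkseq// => i iw.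
by rewrite nth_mkseq// /per modn_small.
Qed.

Lemma per_periodic w k : iter (k * size w) shift_map (per w) = per w.
Proof. by rewrite iter_shift; apply/funext => i; rewrite /per addnC modnMDl. Qed.

Lemma per_head w i : per w (i * size w) = head 0%N w.
Proof. by rewrite /per modnMl nth0. Qed.

Lemma iter_shift_per k w : (k <= size w)%N ->
  iter k shift_map (per w) = per (rot k w).
Proof.
move=> kw; rewrite iter_shift; apply/funext => i; rewrite /per size_rot.
case: (posnP (size w)) => [/size0nil->//|w0]; first by rewrite !nth_nil.
rewrite /rot nth_cat size_drop; set j := (i %% size w)%N.
have jw : (j < size w)%N by rewrite ltn_mod.
rewrite -modnDml -/j.
case: ltnP => h; rewrite ?nth_drop ?nth_take; try lia.
  by rewrite modn_small; [congr (nth _ _ _) | ]; lia.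
have -> : (j + k = (j - (size w - k)) + size w)%N by lia.
by rewrite modnDr modn_small//; lia.
Qed.

Lemma path_iter x k : markov_shift M x ->
  path M (x 0%N) (mkseq (fun i => x i.+1) k).
Proof.
move=> [_ xM]; apply/(pathP 0%N) => i; rewrite size_mkseq => ik.
rewrite nth_mkseq//; case: i ik => [|i] ik //=; rewrite nth_mkseq//; exact: ltnW.
Qed.

Lemma last_mkseqS x k : last (x 0%N) (mkseq (fun i => x i.+1) k) = x k.
Proof.
by case: k => [//|k]; rewrite (last_nth 0%N) size_mkseq -nth_behead nth_mkseq.
Qed.

Lemma mkseqS x k : mkseq x k.+1 = x 0%N :: mkseq (fun i => x i.+1) k.
Proof. by rewrite /mkseq /= (iotaDl 1) -map_comp. Qed.

Lemma rcons_mkseq x k : rcons (mkseq x k) (x k) = mkseq x k.+1.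
Proof. by rewrite /mkseq -addn1 iotaD map_cat cats1. Qed.

(** Two orbit segments, each ending at the first letter of the other, close up
   to a loop; the segment [mkseq x n] omits its last letter [x n]. *)
Lemma loop_splice x n t m : (0 < n)%N -> (0 < m)%N ->
  markov_shift M x -> markov_shift M t -> x n = t 0%N -> t m = x 0%N ->
  loop (mkseq x n ++ mkseq t m).
Proof.
case: n => // n; case: m => // m _ _ Mx Mt xt tx; apply/and3P; split => //.
  by rewrite all_cat; apply/andP; split;
    apply/allP => _ /mapP[i _ ->]; [exact: Mx.1|exact: Mt.1].
rewrite !mkseqS /= -{2}tx rcons_cat rcons_cons rcons_mkseq -xt -cat_rcons.
by rewrite rcons_mkseq cat_path path_iter// last_mkseqS xt path_iter.
Qed.

Lemma loop_per w : loop w -> markov_shift M (per w).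
Proof.
case: w => //= a w /and3P[_ /allP apos cyc]; split=> i.
  by apply: apos; rewrite /per mem_nth// ltn_mod.
move: cyc => /(pathP 0%N); rewrite /per size_rcons; set n := (size (a :: w)).
have im : (i %% n < n)%N by rewrite ltn_mod.
move=> /(_ (i %% n)%N im); rewrite -rcons_cons nth_rcons -/n im.
suff -> : nth 0%N (rcons w a) (i %% n) = nth 0%N (a :: w) (i.+1 %% n) by [].
rewrite nth_rcons.
have -> : (i.+1 %% n = (i %% n).+1 %% n)%N
  by rewrite -[(_ %% _).+1]addn1 modnDml addn1.
have [h|h] := ltnP (i %% n) (size w); first by rewrite [(_.+1 %% _)%N]modn_small.
have -> : (i %% n = size w)%N by apply/eqP; rewrite eqn_leq h andbT -ltnS.
by rewrite eqxx modnn.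
Qed.

Lemma loop_rot k w : loop (rot k w) = loop w.
Proof.
rewrite /loop rot_cycle (perm_all _ (permEl (perm_rot k w))).
by rewrite -!size_eq0 size_rot.
Qed.

Lemma loop_catC u v : loop (u ++ v) = loop (v ++ u).
Proof. by rewrite -rot_size_cat loop_rot. Qed.

Lemma loop_cat b u v :
  loop ((b :: u) ++ (b :: v)) = loop (b :: u) && loop (b :: v).
Proof.
rewrite /loop /= all_cat /= -cat_rcons rcons_cat cat_path last_rcons.
by case: (0 < b)%N => //=; case: (all _ u); case: (all _ v);
   rewrite ?andbF//=.
Qed.

Lemma loop_catI u v : loop u -> loop v -> head 0%N u = head 0%N v ->
  loop (u ++ v).
Proof.
case: u => [//|b u]; case: v => [//|c v] lu lv /= bc; subst c.
by rewrite loop_cat lu lv.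
Qed.

End Loops.

(** * First-return loops *)

Section FirstReturns.
Local Open Scope classical_set_scope.
Variable M : nat -> nat -> bool.
Hypothesis M_transitive : topologically_transitive M.
Implicit Types (b c : nat) (u v w : seq nat) (us ws : seq (seq nat)).

Lemma connecting_path b c : (0 < b)%N -> (0 < c)%N ->
  exists t n, [/\ (0 < n)%N, markov_shift M t, t 0%N = b & t n = c].
Proof.
move=> b0 c0; have [n n0 [t [[Mt tb] [_ tc]]]] := M_transitive b0 c0.
exists t, n; split => //; first exact: (tb 0%N).
by have := tc 0%N isT; rewrite iter_shift.
Qed.

Lemma loop_through b c : (0 < b)%N -> (0 < c)%N ->
  exists u v, [/\ loop M (u ++ v), head 0%N u = b & head 0%N v = c] /\
    (u != [::]) && (v != [::]).
Proof.
move=> b0 c0.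
have [s [n [n0 Ms sb sc]]] := connecting_path b0 c0.
have [t [m [m0 Mt tc tb]]] := connecting_path c0 b0.
exists (mkseq s n), (mkseq t m); split; last by case: n n0 {sc}; case: m m0 {tb}.
split; last by case: m m0 {tb}.
  by apply: loop_splice => //; rewrite ?sc ?tb.
by case: n n0 {sc}.
Qed.

Lemma simple_path b c : (0 < b)%N -> (0 < c)%N ->
  exists p, [/\ path M b p, uniq (b :: p), last b p = c & all (fun a => 0 < a)%N p].
Proof.
move=> b0 c0; have [t [n [_ Mt tb tc]]] := connecting_path b0 c0.
have tpos : all (fun a => 0 < a)%N (mkseq (fun i => t i.+1) n).
  by apply/allP => _ /mapP[i _ ->]; exact: Mt.1.
have := path_iter n Mt; have := last_mkseqS t n; rewrite tb tc => <- pM.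
case/shortenP: pM => p pM puniq psub; exists p; split => //.
by apply/allP => i /psub; exact/allP.
Qed.

(** Shortening the two halves of a loop at [b] through [c] to simple paths
   leaves [b] only at the start. *)
Lemma first_return_through b c : (0 < b)%N -> (0 < c)%N -> b != c ->
  exists s, [/\ loop M (b :: s), b \notin s & c \in s].
Proof.
move=> b0 c0 bc.
have [p [pM /= /andP[bp _] pc ppos]] := simple_path b0 c0.
have [r [rM + rb rpos]] := simple_path c0 b0.
case/lastP: r => [|r d] in rM rb rpos *; first by move/eqP: bc; rewrite -rb.
rewrite last_rcons in rb; subst d => /= /andP[_].
rewrite rcons_uniq => /andP[br _].
exists (p ++ r); split.
- rewrite /loop /= b0 all_cat ppos rcons_cat cat_path pM pc rM !andbT.
  by move: rpos; rewrite all_rcons => /andP[].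
- by rewrite mem_cat negb_or bp.
- rewrite mem_cat; move: pc bc; case: p {bp pM ppos} => [|a p] /= pc.
    by rewrite pc eqxx.
  by rewrite -pc mem_last.
Qed.

(** The second loop is made to pass through a letter absent from the first, so
   it is here that the infinity of the alphabet enters. *)
Lemma two_first_returns b : (0 < b)%N ->
  exists v1 v2, [/\ v1 != v2, loop M (b :: v1), loop M (b :: v2),
    b \notin v1 & b \notin v2].
Proof.
move=> b0.
have [v1 [l1 bv1 _]] :=
  @first_return_through b b.+1 b0 isT (negbT (ltn_eqF (ltnSn b))).
pose c := (b + \sum_(i <- v1) i).+1.
have cb : b != c by rewrite ltn_eqF// ltnS leq_addr.
have cv1 : c \notin v1.
  apply/negP => /perm_to_rem h.
  have : (\sum_(i <- v1) i = c + \sum_(i <- rem c v1) i)%N.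
    by rewrite (perm_big _ h) big_cons.
  by rewrite {1}/c; lia.
have [v2 [l2 bv2 cv2]] := @first_return_through b c b0 isT cb.
exists v1, v2; split => //; by apply: contraNneq cv1 => ->.
Qed.

Definition flat b us := flatten [seq b :: u | u <- us].

Lemma flat_index b u us : b \notin u -> index b (u ++ flat b us) = size u.
Proof.
move=> bu; rewrite index_cat (negPf bu); case: us => [|v us]; first by rewrite addn0.
by rewrite /= eqxx addn0.
Qed.

(** The sequence of return words is recovered by cutting before each [b]. *)
Lemma flat_inj b us ws : all (fun u => b \notin u) us ->
  all (fun u => b \notin u) ws -> flat b us = flat b ws -> us = ws.
Proof.
elim: us ws => [|u us IH] [|w ws] //= /andP[bu bus] /andP[bw bws] [e].
have suw : size u = size w by rewrite -(flat_index us bu) -(flat_index ws bw) e.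
move/eqP: e; rewrite eqseq_cat// => /andP[/eqP-> /eqP e].
by congr (_ :: _); exact: IH.
Qed.

Lemma flat_decomposition b w : exists u us,
  [/\ w = u ++ flat b us, size us = count_mem b w &
      all (fun u => b \notin u) (u :: us)].
Proof.
elim: w => [|a w [u [us [-> sus /= /andP[bu bus]]]]]; first by exists [::], [::].
have [->|ab] := eqVneq a b.
  exists [::], (u :: us); split; rewrite /= ?eqxx ?sus //.
  by rewrite bu.
exists (a :: u), us; split; rewrite /= ?(negPf ab) ?sus //.
by rewrite in_cons negb_or eq_sym ab bu.
Qed.

Section Insertions.
Variables (v1 v2 : seq nat).

Definition differing u := if u == v1 then v2 else v1.

(** All the sequences of return words obtained from [us] by inserting, before
   each entry [u], either nothing or the one of [v1], [v2] that differs from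
   [u].  As what comes first, [u] or something else, records the choice, no
   two choices produce the same sequence. *)
Fixpoint insertions us : seq (seq (seq nat)) :=
  if us is u :: us' then
    [seq u :: ws | ws <- insertions us'] ++
    [seq differing u :: u :: ws | ws <- insertions us']
  else [:: [::]].

Lemma uniq_insertions us : v1 != v2 -> uniq (insertions us).
Proof.
move=> v12; elim: us => [//|u us IH] /=; rewrite cat_uniq !map_inj_uniq ?IH ?andbT//=.
- apply/hasPn => _ /mapP[ws _ ->]; apply/negP => /mapP[ws' _ [+ _]].
  rewrite /differing; case: eqVneq => [->|/eqP uv1 v1u].
    by move/esym/eqP; apply/negP.
  exact/uv1.
- by move=> x y [].
- by move=> x y [].
Qed.

Lemma all_insertions (p : pred (seq nat)) us ws : p v1 -> p v2 -> all p us ->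
  ws \in insertions us -> all p ws.
Proof.
move=> pv1 pv2; elim: us ws => [|u us IH] ws /=; first by rewrite inE => _ /eqP->.
move=> /andP[pu /IH{}IH]; rewrite mem_cat => /orP[] /mapP[ws' /IH ws'P ->] /=.
  by rewrite pu.
by rewrite pu ws'P /differing; case: ifP => _; rewrite ?pv1 ?pv2.
Qed.

Lemma size_insertions b us ws : ws \in insertions us ->
  (size (flat b us) <= size (flat b ws) <=
   size (flat b us) + size us * (size v1 + size v2).+1)%N.
Proof.
elim: us ws => [|u us IH] ws /=; first by rewrite inE => /eqP->.
rewrite mem_cat => /orP[] /mapP[ws' /IH ws'P ->] /=; rewrite ?size_cat /= ?size_cat.
  by move: ws'P; rewrite /flat; lia.
by move: ws'P; rewrite /flat /differing; case: ifP => _; lia.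
Qed.

End Insertions.
End FirstReturns.

(** * Birkhoff sums along loops *)

Section Birkhoff.
Local Open Scope classical_set_scope.
Local Open Scope ring_scope.
Variables (R : realType) (M : nat -> nat -> bool) (phi : (nat -> nat) -> R).
Hypothesis M_transitive : topologically_transitive M.
Hypothesis phi_summable : summable_variations M phi.
Implicit Types (b c : nat) (u v w : seq nat) (x y t : nat -> nat).

Local Notation S := (birkhoff_sum phi).

Lemma birkhoffD n m x : S (n + m) x = S n x + S m (iter n shift_map x).
Proof.
rewrite /birkhoff_sum big_split_ord; congr (_ + _); apply: eq_bigr => i _ /=.
by rewrite addnC iterD.
Qed.

Lemma birkhoff_periodic k n x : iter n shift_map x = x ->
  S (k * n) x = k%:R * S n x.
Proof.
move=> xn; elim: k => [|k IH]; first by rewrite mul0n /birkhoff_sum big_ord0 mul0r.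
by rewrite mulSn birkhoffD xn IH mulrSr mulrDl mul1r addrC.
Qed.

Lemma birkhoff_shift k n x : iter n shift_map x = x ->
  S n (iter k shift_map x) = S n x.
Proof.
move=> xn; apply: (addrI (S k x)); rewrite -birkhoffD addnC birkhoffD xn.
exact: addrC.
Qed.

Lemma variation_ge0 k : (0 <= Defs.variation M phi k)%E.
Proof.
have [t [_ [_ Mt _ _]]] := connecting_path M_transitive (b := 1) (c := 1) isT isT.
apply: ereal_sup_ubound; exists t, t; split => //.
by rewrite subrr normr0.
Qed.

Definition distortion : R := fine (\sum_(2 <= k <oo) Defs.variation M phi k)%E.

(** The [i]-th terms of the two sums agree up to the variation of order
   [n.+1 - i], which is at least [2] because [x n = y n] is assumed too: the
   distortion does not involve the first variation, which may be infinite. *)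
Lemma birkhoff_distortion n x y : markov_shift M x -> markov_shift M y ->
  (forall i, (i <= n)%N -> x i = y i) -> `|S n x - S n y| <= distortion.
Proof.
move=> Mx My xy; rewrite -lee_fin /distortion fineK; last first.
  rewrite ge0_fin_numE; first exact: phi_summable.
  by apply: nneseries_ge0 => k _ _; exact: variation_ge0.
apply: (@le_trans _ _ (\sum_(2 <= k < n.+2) Defs.variation M phi k)%E); last first.
  by apply: nneseries_lim_ge => k _ _; exact: variation_ge0.
apply: (@le_trans _ _ (\sum_(i < n)
    `|phi (iter i shift_map x) - phi (iter i shift_map y)|%:E)%E).
  rewrite sumEFin lee_fin /birkhoff_sum -sumrB; exact: ler_norm_sum.
rewrite -[n.+2]addn2 -[X in (\sum_(X <= _ < _) _)%E]add0n.
rewrite big_addn addnK big_nat_rev big_mkord.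
apply: lee_sum => i _; apply: ereal_sup_ubound.
exists (iter i shift_map x), (iter i shift_map y); split => //.
- exact: markov_shift_iter.
- exact: markov_shift_iter.
- move=> j; rewrite !iter_shift => jn; apply: xy.
  by have := ltn_ord i; lia.
Qed.

Local Notation Sw w := (S (size w) (per w)).

Lemma birkhoff_rot k w : (k <= size w)%N -> Sw (rot k w) = Sw w.
Proof.
move=> kw; rewrite size_rot -iter_shift_per// birkhoff_shift//.
by rewrite -{1}[size w]mul1n per_periodic.
Qed.

Lemma birkhoff_catC u v : Sw (u ++ v) = Sw (v ++ u).
Proof. by rewrite -rot_size_cat birkhoff_rot// size_cat leq_addr. Qed.

Lemma per_splice_l x n t m i : (0 < n)%N -> (0 < m)%N -> x n = t 0%N ->
  (i <= n)%N -> per (mkseq x n ++ mkseq t m) i = x i.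
Proof.
move=> n0 m0 xt; rewrite /per size_cat !size_mkseq => lin.
rewrite modn_small ?nth_cat ?size_mkseq; last by lia.
case: ltnP => h; first by rewrite nth_mkseq.
have -> : i = n by lia.
by rewrite subnn nth_mkseq.
Qed.

Lemma birkhoff_splice x n t m : (0 < n)%N -> (0 < m)%N ->
  markov_shift M x -> markov_shift M t -> x n = t 0%N -> t m = x 0%N ->
  `|Sw (mkseq x n ++ mkseq t m) - (S n x + S m t)| <= distortion *+ 2.
Proof.
move=> n0 m0 Mx Mt xt tx; set u := mkseq x n; set v := mkseq t m.
have [su sv] : size u = n /\ size v = m by rewrite !size_mkseq.
rewrite size_cat birkhoffD iter_shift_per ?size_cat ?leq_addr// rot_size_cat.
rewrite opprD addrACA; apply: le_trans (ler_normD _ _) _.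
rewrite mulr2n su sv; apply: lerD; apply: birkhoff_distortion => //.
- by apply: loop_per; exact: loop_splice.
- by move=> i; exact: per_splice_l.
- by apply: loop_per; exact: loop_splice.
- by move=> i; exact: per_splice_l.
Qed.

Lemma loop_size_gt0 w : loop M w -> (0 < size w)%N.
Proof. by case: w. Qed.

Lemma per_size w : per w (size w) = head 0%N w.
Proof. by rewrite -(per_head w 1) mul1n. Qed.

Lemma per0 w : per w 0 = head 0%N w.
Proof. by rewrite -(per_head w 0). Qed.

Lemma birkhoff_cat u v : loop M u -> loop M v -> head 0%N u = head 0%N v ->
  `|Sw (u ++ v) - (Sw u + Sw v)| <= distortion *+ 2.
Proof.
move=> lu lv uv; rewrite -{1 2}(mkseq_per u) -{1 2}(mkseq_per v).
by apply: birkhoff_splice; rewrite ?per_size ?per0 ?(loop_size_gt0 lu)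
  ?(loop_size_gt0 lv)//; exact: loop_per.
Qed.

(** The insertion is compared with the uninserted loop through the sum of the
   separate pieces; this takes three splices, at [2B] each. *)
Lemma birkhoff_insert u v w : loop M u -> loop M v -> loop M w ->
  head 0%N u = head 0%N v -> head 0%N w = head 0%N v ->
  Sw (u ++ w) + (Sw v - distortion *+ 6) <= Sw (u ++ v ++ w).
Proof.
move=> lu lv lw uv wv.
have lvw : loop M (v ++ w) by exact: loop_catI.
have hvw : head 0%N (v ++ w) = head 0%N v by case: (v) lv.
have := birkhoff_cat lu lvw (etrans uv (esym hvw)).
have := birkhoff_cat lv lw (esym wv); have := birkhoff_cat lu lw (etrans uv (esym wv)).
by rewrite !ler_norml !mulrS !mulr0n; lra.
Qed.

(** A periodic orbit, run through any number of times, is contained in a loop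
   at a prescribed letter at a cost independent of that number. *)
Lemma thread_loop a p x : (0 < a)%N -> (0 < p)%N -> periodic_points M p x ->
  exists (A : nat) (D : R), forall k, (0 < k)%N ->
    exists w, [/\ loop M w, head 0%N w = a, size w = (k * p + A)%N &
      k%:R * S p x - D <= Sw w].
Proof.
move=> a0 p0 [Mx xp].
have [u [v [[lvu hu hv] /andP[u0 v0]]]] := loop_through M_transitive a0 (Mx.1 0%N).
pose g := v ++ u.
have lg : loop M g by rewrite /g loop_catC.
have hg : head 0%N g = x 0%N by rewrite /g; case: (v) v0 hv.
exists (size g), (distortion *+ 2 - Sw g) => k k0.
have kp0 : (0 < k * p)%N by rewrite muln_gt0 k0.
have xkp : iter (k * p) shift_map x = x.
  by elim: k {k0 kp0} => [//|k IH]; rewrite mulSn iterD IH.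
have xkp0 : x (k * p)%N = x 0%N.
  by rewrite -{2}xkp iter_shift.
pose z := mkseq x (k * p).
have lzg : loop M (z ++ g).
  rewrite -(mkseq_per g); apply: loop_splice;
    rewrite ?(loop_size_gt0 lg) ?per_size ?per0//.
  - exact: loop_per.
  - by rewrite hg.
exists (u ++ z ++ v); split.
- by rewrite loop_catC -catA.
- by case: (u) u0 hu.
- by rewrite !size_cat size_mkseq; lia.
rewrite birkhoff_catC -catA -/g -birkhoff_periodic//.
have : `|Sw (z ++ g) - (S (k * p) x + Sw g)| <= distortion *+ 2.
  rewrite -{1 2}(mkseq_per g); apply: birkhoff_splice => //.
  - exact: loop_size_gt0 lg.
  - exact: loop_per.
  - by rewrite per0 hg.
  - by rewrite per_size.
by rewrite ler_norml => /andP[+ _]; lra.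
Qed.

End Birkhoff.

(** * Loops of nearly maximal average visit each letter rarely *)

Section RareVisits.
Local Open Scope classical_set_scope.
Local Open Scope ring_scope.
Variables (R : realType) (M : nat -> nat -> bool) (phi : (nat -> nat) -> R).
Hypothesis M_transitive : topologically_transitive M.
Hypothesis phi_summable : summable_variations M phi.
Implicit Types (b c : nat) (u v w : seq nat) (x y t : nat -> nat).

Local Notation S := (birkhoff_sum phi).
Local Notation Sw w := (S (size w) (per w)).
Local Notation B := (distortion M phi).

(** Distinct loops of the same length have distinct periodic points, so that
   the exponentials of their Birkhoff sums are terms of the sum that defines
   the pressure. *)
Lemma loop_sums_le_pressure a (p Q : R) :
  (gurevich_pressure M phi a <= p%:E)%E -> p < Q ->
  exists N0, forall N (ws : seq (seq nat)), (N0 <= N)%N -> uniq ws ->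
    (forall w, w \in ws -> [/\ loop M w, head 0%N w = a & size w = N]) ->
    \sum_(w <- ws) expR (Sw w) <= expR (N%:R * Q).
Proof.
move=> Pp pQ; have /limn_esup_lt[k kP] : (gurevich_pressure M phi a < Q%:E)%E.
  by apply: le_lt_trans Pp _; rewrite lte_fin.
exists (maxn k 1) => N ws; rewrite geq_max => /andP[kN N0] uws wsP.
have {kP kN} := kP _ kN; set Z := (\esum_(x in _) _)%E => NZ.
have ZQ : (Z <= (expR (N%:R * Q))%:E)%E.
  rewrite leNgt; apply/negP => /ltW ZQ; move: NZ; apply/negP; rewrite -leNgt.
  have -> : Q%:E = ((N%:R^-1)%:E * (N%:R * Q)%:E)%E.
    by rewrite -EFinM mulKf// pnatr_eq0 -lt0n.
  apply: lee_wpmul2l; first by rewrite lee_fin.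
  have -> : (N%:R * Q)%:E = lne (expR (N%:R * Q))%:E.
    by rewrite lne_EFin ?expR_gt0// expRK.
  have Q0 : (0 <= (expR (N%:R * Q))%:E)%E by rewrite lee_fin expR_ge0.
  by rewrite lee_lne// in_itv /= leey ?andbT//; exact: le_trans ZQ.
rewrite -lee_fin; apply: le_trans ZQ; apply: esum_ge.
have pws : {in ws &, injective (@per)}.
  move=> w w' /wsP[_ _ sw] /wsP[_ _ sw'] ww'.
  by rewrite -(mkseq_per w) -(mkseq_per w') ww' sw sw'.
exists [set` [seq per w | w <- ws]].
  split; first exact: finite_seq.
  move=> _ /= /mapP[w /wsP[lw _ <-] ->]; split; first exact: loop_per.
  by rewrite -{1}[size w]mul1n per_periodic.
rewrite -fsbig_seq ?map_inj_in_uniq// big_map -sumEFin big_seq [leRHS]big_seq.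
apply: lee_sum => w /wsP[lw hw sw].
rewrite lee_fin indicE mem_set ?mulr1 ?sw// /markov_cylinder /=; split.
  exact: loop_per.
by case=> // _; rewrite per0.
Qed.

Definition loop_weight (Q : R) w := expR (Sw w - (size w)%:R * Q).
Local Notation E := loop_weight.

Lemma loop_weight_conj Q u s v : E Q ((v ++ u) ++ s) = E Q (u ++ s ++ v).
Proof.
rewrite /loop_weight (birkhoff_catC phi u (s ++ v)).
rewrite (birkhoff_catC phi (v ++ u) s) catA.
have -> : size ((v ++ u) ++ s) = size (u ++ s ++ v).
  by rewrite -catA !size_cat addnC -addnA.
by [].
Qed.

(** Grouping the loops by length, each group of large length weighs at most
   [1]. *)
Lemma loop_weights_le_size a (p Q : R) :
  (gurevich_pressure M phi a <= p%:E)%E -> p < Q ->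
  exists N0, forall N (ws : seq (seq nat)), uniq ws ->
    (forall w, w \in ws -> [/\ loop M w, head 0%N w = a & (N0 <= size w <= N)%N]) ->
    \sum_(w <- ws) E Q w <= N.+1%:R.
Proof.
move=> Pp pQ; have [N0 N0P] := loop_sums_le_pressure Pp pQ.
exists N0 => N ws uws wsP.
rewrite big_seq (partition_big (fun w => inord (size w) : 'I_N.+1) xpredT)//=.
rewrite -[N.+1 in leRHS]card_ord -sumr_const; apply: ler_sum => j _.
have [jN0|N0j] := ltnP j N0.
  rewrite big1// => w /andP[/wsP[_ _ /andP[h1 h2]] /eqP wj].
  by move: jN0; rewrite -wj inordK ?ltnS// ltnNge h1.
rewrite -big_seq_cond -big_filter.
rewrite (eq_big_seq (fun w => expR (Sw w) * expR (- (j%:R * Q)))); last first.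
  move=> w; rewrite mem_filter => /andP[/eqP <- /wsP[_ _ /andP[_ h]]].
  by rewrite inordK ?ltnS// -expRD.
rewrite -mulr_suml expRN ler_pdivrMr ?expR_gt0// mul1r.
apply: N0P => //; first exact: filter_uniq.
move=> w; rewrite mem_filter => /andP[/eqP <- /wsP[lw hw /andP[_ h]]].
by rewrite inordK ?ltnS.
Qed.

Lemma loop_flat b us : us != [::] ->
  loop M (flat b us) = all (fun u => loop M (b :: u)) us.
Proof.
elim: us => [//|u [|u' us] IH] _; first by rewrite /flat /= cats0 andbT.
by rewrite -[flat _ _]/((b :: u) ++ b :: (u' ++ flat b us)) loop_cat IH.
Qed.

(** Inserting at a visit multiplies the weight by at least [r], so that the
   two options offered at each visit multiply the total weight by [1 + r].  The
   prefix [pre] is what the induction has already processed; the condition that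
   it be a nonempty loop makes every insertion one between two loops. *)
Lemma insertions_weight b v1 v2 (Q r : R) : 0 <= r ->
  (forall v, v \in [:: v1; v2] -> loop M (b :: v) /\
     r <= expR (Sw (b :: v) - B *+ 6 - (size (b :: v))%:R * Q)) ->
  forall us pre, loop M pre -> head 0%N pre = b ->
  all (fun u => loop M (b :: u)) us ->
  (1 + r) ^+ size us * E Q (pre ++ flat b us) <=
  \sum_(ws <- insertions v1 v2 us) E Q (pre ++ flat b ws).
Proof.
move=> r0 vP; elim=> [|u us IH] pre lpre hpre /=; first by rewrite big_seq1 mul1r.
move=> /andP[lu lus]; rewrite big_cat !big_map /=.
have dP : differing v1 v2 u \in [:: v1; v2].
  by rewrite /differing; case: ifP; rewrite !inE eqxx ?orbT.
move: (differing v1 v2 u) dP => d /vP[ld rd].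
have lpu : loop M (pre ++ b :: u) by exact: loop_catI.
have lpdu : loop M (pre ++ (b :: d) ++ b :: u).
  by apply: loop_catI => //; exact: loop_catI.
have hpu v : head 0%N (pre ++ v) = b by case: (pre) lpre hpre.
have flatE ws : flat b (u :: ws) = (b :: u) ++ flat b ws by [].
rewrite [X in _ <= X + _](eq_bigr (fun ws =>
    E Q ((pre ++ b :: u) ++ flat b ws))); last first.
  by move=> ws _; rewrite flatE catA.
rewrite [X in _ <= _ + X](eq_bigr (fun ws =>
    E Q ((pre ++ (b :: d) ++ b :: u) ++ flat b ws))); last first.
  by move=> ws _; rewrite -!catA.
apply: le_trans (lerD (IH _ lpu (hpu _) lus) (IH _ lpdu (hpu _) lus)).
have lw : loop M (flat b (u :: us)) by rewrite loop_flat//= lu.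
have := birkhoff_insert M_transitive phi_summable lpre ld lw hpre erefl => Eins.
rewrite -mulrDr exprSr -mulrA; apply: ler_wpM2l; first by rewrite exprn_ge0// addr_ge0.
rewrite mulrDl mul1r -!catA -flatE; apply: lerD => //.
apply: (@le_trans _ _ (expR (Sw (b :: d) - B *+ 6 - (size (b :: d))%:R * Q) *
   E Q (pre ++ flat b (u :: us)))).
  by apply: ler_wpM2r rd; exact: expR_ge0.
rewrite -expRD ler_expR; move: Eins; set s1 := Sw _; set s2 := Sw _; set s3 := Sw _.
rewrite !size_cat !natrD; lra.
Qed.

Lemma expR_gt_linear (A A' K g : R) : 0 < K -> 0 < g ->
  exists n0, forall n, (n0 <= n)%N -> A + n%:R * A' < K * expR (n%:R * g).
Proof.
move=> K0 g0; pose T := 2 * (`|A| + `|A'|) / (K * g ^+ 2).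
have T0 : 0 <= T by rewrite divr_ge0 ?mulr_ge0 ?addr_ge0 ?exprn_ge0// ltW.
exists (Num.trunc T).+1 => n nT.
have n1 : 1 <= n%:R :> R by rewrite ler1n; exact: leq_trans nT.
have Tn : T < n%:R.
  by apply: lt_le_trans (_ : (Num.trunc T).+1%:R <= _); rewrite ?truncnS_gt ?ler_nat.
apply: (@le_lt_trans _ _ (n%:R * (`|A| + `|A'|))).
  rewrite mulrDr; apply: lerD; last by apply: ler_wpM2l => //; exact: ler_norm.
  by apply: le_trans (ler_norm _) _; rewrite ler_peMl.
apply: (@lt_le_trans _ _ (K * (1 + (n%:R * g) ^+ 2 / 2))); last first.
  apply: ler_wpM2l; first exact: ltW.
  by have := @expR_ge1Dxn R (n%:R * g) 1; apply; rewrite mulr_ge0// ltW.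
move: Tn; rewrite /T ltr_pdivrMr ?mulr_gt0 ?exprn_gt0// => Tn.
rewrite -subr_gt0.
have : 0 < n%:R * (n%:R * (K * g ^+ 2) - 2 * (`|A| + `|A'|)).
  by rewrite mulr_gt0 ?subr_gt0//; lra.
nra.
Qed.

(** A loop violating the bound would, by insertions at its many visits to
   [b], produce loops at [a] of total weight exponentially large in the length
   [n] of the loop, while all lengths stay at most linear in [n]. *)
Lemma rare_visits a b (p cst : R) : (0 < a)%N -> (0 < b)%N -> 0 < cst ->
  (gurevich_pressure M phi a <= p%:E)%E ->
  exists2 e : R, 0 < e & exists n0, forall w, loop M w -> (n0 <= size w)%N ->
    (size w)%:R * (p - e) <= Sw w -> (count_mem b w)%:R < cst * (size w)%:R.
Proof.
move=> a0 b0 cst0 Pp.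
have [v1 [v2 [v12 l1 l2 bv1 bv2]]] := two_first_returns M_transitive b0.
(* [p + 1] bounds the exponent [p + e] in use, so [r] does not depend on [e] *)
pose f v := expR (Sw (b :: v) - B *+ 6 - (size (b :: v))%:R * (p + 1)).
pose r := Num.min (f v1) (f v2).
have r0 : 0 < r by rewrite /r lt_min !expR_gt0.
have lnr : 0 < ln (1 + r) by rewrite ln_gt0// ltrDl.
pose g := cst * ln (1 + r); have g0 : 0 < g by rewrite mulr_gt0.
pose e := Num.min 1 (g / 4).
have e0 : 0 < e by rewrite /e lt_min ltr01 divr_gt0.
have e1 : e <= 1 by rewrite ge_min lexx.
have eg : e <= g / 4 by rewrite ge_min lexx orbT.
have pQ : p < p + e by rewrite ltrDl.
have [N0 N0P] := loop_weights_le_size Pp pQ.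
have [u [v [[luv hu hv] /andP[u0 v0]]]] := loop_through M_transitive a0 b0.
pose h := v ++ u; pose Q := p + e.
have lh : loop M h by rewrite /h loop_catC.
have hh : head 0%N h = b by rewrite /h; case: (v) v0 hv.
(* [h] leads from [b] to [a] and back: it moves the loops built at [b] to [a] *)
pose K := expR (Sw h - B *+ 2 - (size h)%:R * Q).
pose L := (size v1 + size v2).+1.
have [n1 n1P] := @expR_gt_linear ((size h)%:R + 1) L.+1%:R K (g / 2) (expR_gt0 _)
  (divr_gt0 g0 (ltr0n _ 2)).
exists e => //; exists (maxn N0 n1) => w lw; rewrite geq_max => /andP[N0w n1w] Sww.
rewrite ltNge; apply/negP => cw.
have w0 : 0 < (size w)%:R :> R by rewrite ltr0n; exact: loop_size_gt0 lw.
have bw : b \in w.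
  rewrite -has_pred1 has_count -(ltr_nat R); apply: lt_le_trans cw.
  by rewrite mulr_gt0.
have iw : (index b w <= size w)%N by exact: index_size.
set w' := rot (index b w) w.
have lw' : loop M w' by rewrite loop_rot.
have Sw' : Sw w' = Sw w by rewrite /w' birkhoff_rot.
have sw' : size w' = size w by rewrite size_rot.
have cw' : count_mem b w' = count_mem b w by apply/permP; rewrite perm_rot.
have hw' : head 0%N w' = b by rewrite /w' rot_index.
have [t [us [w'E sus /= /andP[bt bus]]]] := flat_decomposition b w'.
have tE : t = [::].
  case: t w'E bt => [//|c t] w'E; move: hw'; rewrite w'E /= => ->.
  by rewrite inE eqxx.
rewrite {}tE /= in w'E.
have us0 : us != [::].
  apply/eqP => us0; move: sus; rewrite us0 cw' => /esym/eqP.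
  by rewrite -leqn0 leqNgt -has_count has_pred1 bw.
have lus : all (fun s => loop M (b :: s)) us by rewrite -loop_flat// -w'E.
have rP s : s \in [:: v1; v2] -> loop M (b :: s) /\
    r <= expR (Sw (b :: s) - B *+ 6 - (size (b :: s))%:R * Q).
  move=> sv; have rf : r <= f s.
    by move: sv; rewrite !inE => /orP[] /eqP->; rewrite ge_min lexx ?orbT.
  split; first by move: sv; rewrite !inE => /orP[] /eqP->.
  by apply: le_trans rf _; rewrite ler_expR lerD2l lerN2 ler_wpM2l// lerD2l.
have lower := insertions_weight (ltW r0) rP lh hh lus.
pose W := [seq u ++ flat b ws ++ v | ws <- insertions v1 v2 us].
have upper : \sum_(x <- W) E Q x <= (size h + size w + size us * L).+1%:R.
  have flatP ws : ws \in insertions v1 v2 us ->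
      loop M (flat b ws) /\ head 0%N (flat b ws) = b.
    move=> wsP; have ws0 : ws != [::].
      case: (us) us0 wsP => // s us' _ /=; rewrite mem_cat.
      by case/orP => /mapP[? _ ->].
    split; last by case: (ws) ws0.
    rewrite loop_flat//.
    by apply: (all_insertions (p := fun s => loop M (b :: s))) wsP.
  apply: N0P.
    rewrite map_inj_in_uniq ?uniq_insertions// => ws ws' wsP ws'P /eqP.
    rewrite eqseq_cat// eqxx /= => /eqP /(congr1 rev); rewrite !rev_cat => /eqP.
    rewrite eqseq_cat// eqxx /= => /eqP /(can_inj revK).
    by apply: flat_inj;
      apply: (all_insertions (p := fun s => b \notin s) bv1 bv2 bus).
  move=> _ /mapP[ws wsP ->]; have [lws hws] := flatP _ wsP; split.
  - by rewrite loop_catC -catA loop_catI// hws.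
  - by case: (u) u0 hu.
  rewrite /h !size_cat.
  have := size_insertions b wsP; rewrite -w'E sw' -/L => /andP[lo up].
  by clear -N0w lo up; lia.
have {}lower : (1 + r) ^+ size us * E Q (h ++ w') <= \sum_(x <- W) E Q x.
  rewrite w'E; apply: le_trans lower _; rewrite big_map le_eqVlt; apply/orP; left.
  by apply/eqP; apply: eq_bigr => ws _; exact: loop_weight_conj.
have Ehw : K * expR (- ((size w)%:R * (g / 2))) <= E Q (h ++ w').
  rewrite -expRD ler_expR size_cat natrD sw'.
  have := birkhoff_cat M_transitive phi_summable lh lw' (etrans hh (esym hw')).
  rewrite Sw' size_cat sw' ler_norml => /andP[+ _].
  have ne : (size w)%:R * e <= (size w)%:R * (g / 4) by rewrite ler_wpM2l.
  by move: Sww ne; rewrite /Q; lra.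
(* this is where many visits to [b] are used *)
have gain : expR ((size w)%:R * g) <= (1 + r) ^+ size us.
  rewrite -[1 + r]lnK ?posrE ?addr_gt0// -expRM_natl ler_expR.
  by rewrite sus cw' /g mulrCA mulrA; apply: ler_wpM2r cw; exact: ltW.
have := n1P _ n1w; apply/negP; rewrite -leNgt.
apply: (@le_trans _ _ (size h + size w + size us * L).+1%:R); last first.
  have : (size us <= size w)%N by rewrite sus cw' count_size.
  move=> usw; rewrite -natrM natr1 -natrD ler_nat; clear -usw; nia.
apply: le_trans upper; apply: le_trans lower.
have -> : K * expR ((size w)%:R * (g / 2)) =
    expR ((size w)%:R * g) * (K * expR (- ((size w)%:R * (g / 2)))).
  by rewrite (mulrCA (expR _) K); congr (K * _); rewrite -expRD; congr expR; lra.
by apply: ler_pM gain Ehw; rewrite ?mulr_ge0// expR_ge0.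
Qed.

End RareVisits.

(** * The implications between the three conditions *)

Section Implications.
Local Open Scope classical_set_scope.
Local Open Scope ring_scope.
Variables (R : realType) (M : nat -> nat -> bool) (phi : (nat -> nat) -> R).
Hypothesis M_transitive : topologically_transitive M.
Hypothesis phi_summable : summable_variations M phi.
Implicit Types (b c : nat) (u v w : seq nat) (x y t : nat -> nat) (P : \bar R).

Local Notation S := (birkhoff_sum phi).
Local Notation Sw w := (S (size w) (per w)).
Local Notation B := (distortion M phi).

Lemma ex_real_between (x : \bar R) (p : R) : (x < p%:E)%E ->
  exists2 c : R, (x < c%:E)%E & c < p.
Proof.
case: x => [r| |] //; rewrite ?lte_fin => rp.
  by exists ((r + p) / 2); rewrite ?lte_fin; lra.
by exists (p - 1); rewrite ?ltNyr//; lra.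
Qed.

Lemma ex_nat_gt (r T : R) : 0 < r -> exists2 k, (0 < k)%N & T < k%:R * r.
Proof.
move=> r0; exists (Num.trunc (`|T| / r)).+1 => //.
rewrite -ltr_pdivrMr//; apply: (@le_lt_trans _ _ (`|T| / r)).
  by rewrite ler_pM2r ?invr_gt0// ler_norm.
exact: truncnS_gt.
Qed.

Lemma nonempty_periodic : exists n x, (0 < n)%N /\ periodic_points M n x.
Proof.
have [u [v [[l _ _] /andP[u0 _]]]] := loop_through M_transitive (b := 1) (c := 1) isT isT.
exists (size (u ++ v)), (per (u ++ v)); split; first exact: loop_size_gt0 l.
by split; [exact: loop_per|rewrite -{1}[size _]mul1n per_periodic].
Qed.

(** Threading a periodic orbit through [a] many times turns the bound on
   returns to a single compact part into a bound on all periodic orbits. *)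
Lemma CRC_UCS P : CRC M phi P -> UCS M phi P.
Proof.
move=> /(_ 1%N isT)[C [l [lP Cl]]]; apply: le_lt_trans lP.
apply: ge_ereal_sup => _ [n [x [n0 xper ->]]]; rewrite lee_fin.
rewrite mulrC ler_pdivrMr ?ltr0n// leNgt; apply/negP => Sl.
have [A [D AD]] := thread_loop M_transitive phi_summable (a := 1) isT n0 xper.
have [|k k0 kT] := @ex_nat_gt (S n x - l * n%:R) (C + D + A%:R * l).
  by rewrite subr_gt0.
have [w [lw hw sw kS]] := AD _ k0.
have := Cl _ _ (loop_size_gt0 lw) (loop_per lw).
rewrite per_size per0 hw => /(_ isT isT); rewrite {2}sw natrD natrM.
by move: kS kT; lra.
Qed.

(** Closing up an orbit segment by one of the finitely many connecting paths
   between letters that are at most [q] costs a bounded amount. *)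
Lemma UCS_returns P : (P < +oo)%E -> UCS M phi P ->
  exists2 l : R, (l%:E < P)%E & forall q, exists C : R, forall n x,
    (0 < n)%N -> markov_shift M x -> (x 0 <= q)%N -> (x n <= q)%N ->
    S n x <= C + n%:R * l.
Proof.
move=> Py chiP; have [l lE lP] : exists2 l : R, chi_per M phi = l%:E & (l%:E < P)%E.
  have [n [x [n0 xper]]] := nonempty_periodic.
  have : ((n%:R^-1 * S n x)%:E <= chi_per M phi)%E.
    by apply: ereal_sup_ubound; exists n, x.
  move: chiP; rewrite /UCS; case: (chi_per M phi) => [l| |] //.
    by exists l.
  by move=> /(lt_trans)/(_ Py); rewrite ltxx.
have loopl w : loop M w -> Sw w <= (size w)%:R * l.
  move=> lw; have sw0 := loop_size_gt0 lw.
  rewrite mulrC -ler_pdivrMr ?ltr0n// mulrC -lee_fin -lE; apply: ereal_sup_ubound.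
  exists (size w), (per w); split => //; split; first exact: loop_per.
  by rewrite -{1}[size _]mul1n per_periodic.
exists l => // q.
have pairC d e : exists C : R, forall n x, (0 < n)%N -> markov_shift M x ->
    x 0%N = d -> x n = e -> S n x <= C + n%:R * l.
  have [/andP[d0 e0]|de] := boolP ((0 < d) && (0 < e))%N; last first.
    exists 0 => n x _ Mx xd xe; case/negP: de.
    by rewrite -xd -xe !Mx.1.
  have [t [m [m0 Mt te td]]] := connecting_path M_transitive e0 d0.
  exists (m%:R * l - S m t + B *+ 2) => n x n0 Mx xd xe.
  have lw : loop M (mkseq x n ++ mkseq t m).
    by apply: loop_splice => //; rewrite ?xe ?xd.
  have := loopl _ lw; rewrite [in X in _ <= X]size_cat !size_mkseq natrD.
  have := birkhoff_splice M_transitive phi_summable n0 m0 Mx Mt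
    (etrans xe (esym te)) (etrans td (esym xd)).
  by rewrite ler_norml => /andP[+ _]; lra.
have /choice[C CP] : forall de : nat * nat, exists C : R, forall n x, (0 < n)%N ->
    markov_shift M x -> x 0%N = de.1 -> x n = de.2 -> S n x <= C + n%:R * l.
  by case=> d e; exact: pairC.
exists (\sum_(i < q.+1) \sum_(j < q.+1) `|C (i : nat, j : nat)|) => n x n0 Mx x0q xnq.
apply: (le_trans (CP (x 0%N, x n) n x n0 Mx erefl erefl)); rewrite lerD2r.
rewrite -ltnS in x0q; rewrite -ltnS in xnq.
rewrite (bigD1 (Ordinal x0q))//= (bigD1 (Ordinal xnq))//= -addrA.
apply: le_trans (ler_norm _) _; rewrite lerDl addr_ge0 ?sumr_ge0// => i _.
exact: sumr_ge0.
Qed.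

Lemma UCS_CRC P : (P < +oo)%E -> UCS M phi P -> CRC M phi P.
Proof.
move=> Py /(UCS_returns Py)[l lP returns] q q0.
by have [C CP] := returns q; exists C, l.
Qed.

Lemma UCS_CI P : (P < +oo)%E -> UCS M phi P -> CI M phi P.
Proof.
move=> Py /(UCS_returns Py)[l + returns]; case: P Py => [p| |] // _; rewrite lte_fin => lp.
apply: (@le_lt_trans _ _ ((l + p) / 2)%:E); last by rewrite lte_fin; lra.
apply: limn_einf_le => q; exists q => //.
apply: limn_einf_le => K; exists K => //.
have [C CP] := returns q.
have [|k k0 kC] := @ex_nat_gt ((p - l) / 2) C; first lra.
apply: (@limn_esup_le _ _ _ k) => n kn; have n0 := leq_trans k0 kn.
apply: ge_ereal_sup => _ [_ [x [[w [sw _ -> [w0 wn] _]] [Mx xw] ->]]].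
rewrite lee_fin mulrC ler_pdivrMr ?ltr0n//.
have := CP n x n0 Mx; rewrite !xw ?sw// => /(_ w0 wn).
have : k%:R * ((p - l) / 2) <= n%:R * ((p - l) / 2).
  by rewrite ler_wpM2r ?ler_nat//; lra.
by move: kC; lra.
Qed.

(** The constant is halved at each letter, which is why [cst] is arbitrary in
   the induction. *)
Lemma rare_visits_le a q (p cst : R) : (0 < a)%N -> 0 < cst ->
  (gurevich_pressure M phi a <= p%:E)%E ->
  exists2 e : R, 0 < e & exists n0, forall w, loop M w -> (n0 <= size w)%N ->
    (size w)%:R * (p - e) <= Sw w ->
    (count (fun c => c <= q)%N w)%:R < cst * (size w)%:R.
Proof.
move=> a0 + Pp; elim: q cst => [|q IH] cst cst0.
  exists 1 => //; exists 0%N => w lw _ _.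
  rewrite (eq_in_count (a2 := pred0)) ?count_pred0.
    by rewrite mulr_gt0// ltr0n; exact: loop_size_gt0 lw.
  case/and3P: lw => _ /allP wpos _ c /wpos; by case: c.
have cst2 : 0 < cst / 2 by rewrite divr_gt0.
have [e1 e10 [n1 n1P]] := IH _ cst2.
have [e2 e20 [n2 n2P]] := rare_visits M_transitive phi_summable a0 (ltn0Sn q) cst2 Pp.
exists (Num.min e1 e2); first by rewrite lt_min e10.
exists (maxn n1 n2) => w lw; rewrite geq_max => /andP[n1w n2w] Sww.
have le12 e : Num.min e1 e2 <= e -> (size w)%:R * (p - e) <= Sw w.
  by move=> ee; apply: le_trans Sww; rewrite ler_wpM2l// lerD2l lerN2.
have := n1P w lw n1w (le12 _ _); rewrite ge_min lexx => /(_ isT).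
have := n2P w lw n2w (le12 _ _); rewrite ge_min lexx orbT => /(_ isT).
suff -> : count (fun c => c <= q.+1)%N w =
  (count (fun c => c <= q)%N w + count_mem q.+1 w)%N by rewrite natrD; lra.
elim: (w) => //= c s ->; rewrite leq_eqVlt ltnS.
by case: eqVneq => [->|_]; rewrite ?ltnn; lia.
Qed.

(** The excursion word repeats the first letter at its end, hence contains one
   small letter more than the loop; the factor [2] and the lower bound on the
   length absorb it. *)
Lemma loop_excursion a q K w : loop M w -> head 0%N w = a -> (a <= q)%N ->
  (0 < K)%N -> (K * 2 <= size w)%N ->
  (count (fun c => c <= q)%N w)%:R < (K%:R * 2)^-1 * (size w)%:R :> R ->
  excursion_cylinders M (size w) K q (markov_cylinder M (rcons w a)).
Proof.
case: w => [//|b s] /and3P[_ pos cyc] /= ba aq K0 K2 cnt; subst b.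
exists (rcons (a :: s) a); split => //=.
- by rewrite size_rcons.
- rewrite /admissible /= (cyc : path M a (rcons s a)) all_rcons andbT.
  by move: pos => /= /andP[-> ->].
- by split => //; rewrite nth_rcons ltnn eqxx.
have K0' : 0 < K%:R :> rat by rewrite ltr0n.
rewrite ler_pdivlMr// -natrM ler_nat -cats1 count_cat /= aq !addn0.
move: cnt; rewrite mulrC ltr_pdivlMr; last by rewrite mulr_gt0 ?ltr0n.
rewrite /= aq -!natrM ltr_nat; move: K2 => /=; nia.
Qed.

(** If periodic averages came close to the pressure, threading would give long
   loops at [a] with such averages; visiting the letters up to [q] rarely, they
   would be excursions that violate the contraction at infinity. *)
Lemma CI_UCS a : (0 < a)%N -> (gurevich_pressure M phi a < +oo)%E ->
  CI M phi (gurevich_pressure M phi a) -> UCS M phi (gurevich_pressure M phi a).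
Proof.
move=> a0; have := @rare_visits_le a; rewrite /CI /UCS.
case: (gurevich_pressure M phi a) => [p| |] // rare _; last by rewrite ltNge leNye.
move=> /(limn_einf_lt a)[q aq].
move=> /(limn_einf_lt 1)[K K0].
move=> /ex_real_between[c /limn_esup_lt[n1 n1P] cp].
rewrite ltNge; apply/negP => pchi.
have cst0 : 0 < (K%:R * 2)^-1 :> R by rewrite invr_gt0 mulr_gt0 ?ltr0n.
have [e e0 [n0 n0P]] := rare q p _ a0 cst0 (lexx _).
(* averages at least [p - d] are both high enough for the rarity of visits and
   above the bound [c] on excursions *)
pose d := Num.min e (p - c).
have d0 : 0 < d by rewrite lt_min e0 subr_gt0.
have de : d <= e by rewrite ge_min lexx.
have dc : c <= p - d by have : d <= p - c by [rewrite ge_min lexx orbT]; lra.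
have [_ [m [x [m0 xper ->]]]] : exists2 y, [set r | exists (n : nat) (x : nat -> nat),
    [/\ (0 < n)%N, periodic_points M n x & r = (n%:R^-1 * S n x)%:E]] y &
    ((p - d / 2)%:E < y)%E.
  by apply: ereal_sup_gt; apply: lt_le_trans pchi; rewrite lte_fin; lra.
rewrite lte_fin (mulrC m%:R^-1) ltr_pdivlMr ?ltr0n// => xp.
have [A [D AD]] := thread_loop M_transitive phi_summable a0 m0 xper.
have [|k1 k10 k1T] := @ex_nat_gt (d / 2) (D + A%:R * (p - d)); first lra.
pose k := (k1 + (n0 + n1 + K * 2))%N.
have k0 : (0 < k)%N by rewrite addn_gt0 k10.
have [w [lw hw sw Sww]] := AD _ k0.
have kw : (k <= size w)%N by rewrite sw; nia.
have Nw : (size w)%:R * (p - d) <= Sw w.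
  apply: le_trans Sww; rewrite sw natrD natrM.
  have k1k : k1%:R * (d / 2) <= k%:R * (m%:R * (d / 2)).
    rewrite (mulrA k%:R) -natrM ler_wpM2r ?ler_nat//; first lra.
    by rewrite /k; nia.
  have := ler_wpM2l (ler0n R k) (ltW xp); lra.
have cnt := n0P w lw.
have {}cnt : (count (fun c => c <= q)%N w)%:R < (K%:R * 2)^-1 * (size w)%:R :> R.
  apply: cnt; first by move: kw; rewrite /k; clear; lia.
  by apply: le_trans Nw; rewrite ler_wpM2l// lerD2l lerN2.
have Kw : (K * 2 <= size w)%N by move: kw; rewrite /k; clear; lia.
have exc := loop_excursion lw hw aq K0 Kw cnt.
have n1w : (n1 <= size w)%N by move: kw; rewrite /k; clear; lia.
have := n1P _ n1w; apply/negP; rewrite -leNgt.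
apply: (@le_trans _ _ ((size w)%:R^-1 * Sw w)%:E).
  rewrite lee_fin mulrC ler_pdivlMr ?ltr0n ?(loop_size_gt0 lw)// mulrC.
  by apply: le_trans Nw; rewrite ler_wpM2l.
apply: ereal_sup_ubound; exists (markov_cylinder M (rcons w a)), (per w).
split; [exact: exc| |by []].
split; first exact: loop_per.
move=> i; rewrite size_rcons ltnS nth_rcons leq_eqVlt => /orP[/eqP->|iw].
  by rewrite ltnn eqxx per_size.
by rewrite iw /per modn_small.
Qed.

End Implications.

Theorem theorem2p6 (R : realType) (M : nat -> nat -> bool)
  (hM : topologically_transitive M)
  (hF : F_property M)
  (phi : (nat -> nat) -> R)
  (hphi : summable_variations M phi)
  (a : nat) (ha : (0 < a)%N)
  (hP : (gurevich_pressure M phi a < +oo)%E) :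
  (UCS M phi (gurevich_pressure M phi a) <->
   CRC M phi (gurevich_pressure M phi a)) /\
  (CRC M phi (gurevich_pressure M phi a) <->
   CI M phi (gurevich_pressure M phi a)).
Proof.
split; split.
- exact: UCS_CRC.
- exact: CRC_UCS.
- by move=> /(CRC_UCS hM hphi); exact: UCS_CI.
- by move=> /(CI_UCS hM hphi ha hP); exact: UCS_CRC.
Qed.
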